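(* Let $K$ be a Kan complex, let $n\ge 1$ and $k\in\{0,\dots,n\}$, and let $c=(x_0,\dots,x_{k-1},y,x_{k+1},\dots,x_n)$ be an $(n-1)$-boundary in $K$. Let $y'\in K_{n-1}$ satisfy $\partial y'=\partial y$, so that $c'=(x_0,\dots,x_{k-1},y',x_{k+1},\dots,x_n)$ is an $(n-1)$-cycle. Then $c'$ is an $(n-1)$-boundary if and only if $y\sim y'$.
   Context: For a simplicial set $K$ with face maps $d_i$ and degeneracy maps $s_i$, write $[n]=\{0,\dots,n\}$ and $\partial x=(d_0x,\dots,d_nx)$ for $x\in K_n$. For $n=0$ conditions involving faces of $0$-simplices are vacuous (so any two $0$-simplices have the same boundary). An $(n+2)$-tuple $(x_0,\dots,x_{n+1})$ of $n$-simplices is an $n$-cycle if $d_ix_j=d_{j-1}x_i$ for all $i<j$ in $[n+1]$; it is an $n$-boundary (''is filled'') if there is an $(n+1)$-simplex $x$ with $\partial x=(x_0,\dots,x_{n+1})$. An $(n,k)$-horn is a tuple $(x_0,\dots,x_{k-1},?,x_{k+1},\dots,x_{n+1})$ of $n$-simplices with the $k$-th entry unspecified, satisfying $d_ix_j=d_{j-1}x_i$ for all $i<j$ different from $k$; a filling of it is an $(n+1)$-simplex $x$ with $d_ix=x_i$ for all $i\neq k$. A Kan complex is a simplicial set in which every horn has a filling. Two $n$-simplices $x,y$ of a Kan complex with $\partial x=\partial y$ are homotopic, $x\sim y$, if the $n$-cycle $(s_{n-1}d_0x,\dots,s_{n-1}d_{n-1}x,x,y)$ is a boundary (for $n=0$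 this cycle is $(x,y)$). *)

(* Defs.v *)
From mathcomp Require Import all_boot.

Set Implicit Arguments.
Unset Strict Implicit.
Unset Printing Implicit Defensive.

(* Every [inord] below is applied to an integer that is in range, by the
   inequality assumed between the indices. *)
Record sset := SSet {
  simplex :> nat -> Type;
  face : forall n, 'I_n.+2 -> simplex n.+1 -> simplex n;
  degen : forall n, 'I_n.+1 -> simplex n -> simplex n.+1;
  face_face : forall n (i j : 'I_n.+3) (x : simplex n.+2), i < j ->
    face (inord i) (face j x) = face (inord j.-1) (face i x);
  degen_degen : forall n (i j : 'I_n.+1) (x : simplex n), i <= j ->
    degen (inord i) (degen j x) = degen (inord j.+1) (degen i x);
  face_degen_lt : forall n (i : 'I_n.+3) (j : 'I_n.+2) (x : simplex n.+1),
    i < j -> face i (degen j x) = degen (inord j.-1) (face (inord i) x);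
  face_degen_id : forall n (i : 'I_n.+2) (j : 'I_n.+1) (x : simplex n),
    (i == j :> nat) || (i == j.+1 :> nat) -> face i (degen j x) = x;
  face_degen_gt : forall n (i : 'I_n.+3) (j : 'I_n.+2) (x : simplex n.+1),
    j.+1 < i -> face i (degen j x) = degen (inord j) (face (inord i.-1) x)
}.

Section SimplicialSet.
Variable K : sset.

Definition same_boundary n : K n -> K n -> Prop :=
  match n with
  | 0 => fun _ _ => True
  | m.+1 => fun x y => forall i : 'I_m.+2, face i x = face i y
  end.

Definition is_cycle n : ('I_n.+2 -> K n) -> Prop :=
  match n with
  | 0 => fun _ => True
  | m.+1 => fun x => forall i j : 'I_m.+3, i < j ->
      face (inord i) (x j) = face (inord j.-1) (x i)
  end.

Definition is_boundary n (x : 'I_n.+2 -> K n) : Prop :=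
  exists z : K n.+1, forall i, face i z = x i.

Definition is_horn n (k : 'I_n.+2) :
    ({i : 'I_n.+2 | i != k} -> K n) -> Prop :=
  match n as n0 return forall k : 'I_n0.+2,
    ({i : 'I_n0.+2 | i != k} -> K n0) -> Prop
  with
  | 0 => fun _ _ => True
  | m.+1 => fun k x => forall i j : {i : 'I_m.+3 | i != k}, val i < val j ->
      face (inord (val i)) (x j) = face (inord (val j).-1) (x i)
  end k.

Definition is_kan : Prop :=
  forall n (k : 'I_n.+2) (x : {i : 'I_n.+2 | i != k} -> K n), is_horn x ->
    exists z : K n.+1, forall i, face (val i) z = x i.

(* The tuple (s_{n-1} d_0 x, ..., s_{n-1} d_{n-1} x, x, y). *)
Definition homotopy_cycle n : K n -> K n -> 'I_n.+2 -> K n :=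
  match n with
  | 0 => fun x y i => if val i == 0 then x else y
  | m.+1 => fun x y i =>
      if i < m.+1 then degen ord_max (face (inord i) x)
      else if val i == m.+1 then x else y
  end.

Definition homotopic n (x y : K n) : Prop :=
  same_boundary x y /\ is_boundary (homotopy_cycle x y).

End SimplicialSet.

(* Main.v *)
Require Import Defs.
From mathcomp Require Import all_boot.

(** The proof rests on a symmetry between two faces of a simplex [w] of
    dimension [n.+2].  For [p < q] the faces [d_p w] and [d_q w] share the
    [n]-simplex [d_p d_q w = d_(q-1) d_p w], and the remaining faces of [w] put
    no condition on these two entries.  Replace this common simplex by an
    arbitrary [e].  The remaining faces of [w] are still there, so horn filling
    turns a filling of either one of the two modified boundaries into a filling
    of the other ([exchange_common_face]).

    Let [z] fill the boundary with [k]-th entry [y].  A suitable degeneracy [w]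
    of [z] has [z] and [s_n y] as its [k]-th and last faces, in one order or
    the other: [s_(n+1) z] if [k <= n], and [s_n z] if [k = n+1].  In both
    cases they share [y].  Replacing [y] by [y'] in the boundary of [z] gives
    the tuple of the theorem, and replacing it in the boundary of [s_n y] gives
    the tuple [(s_(n-1) d_0 y, ..., s_(n-1) d_(n-1) y, y, y')] that defines
    homotopy ([homotopy_cycleE]). *)

Lemma eq_is_boundary {K : sset} {n} {b c : 'I_n.+2 -> K n} :
  b =1 c -> is_boundary b <-> is_boundary c.
Proof.
by move=> bc; split=> -[z hz]; exists z => i; rewrite hz bc.
Qed.

Lemma is_boundary_cycle {K : sset} {n} {b : 'I_n.+2 -> K n} :
  is_boundary b -> is_cycle b.
Proof.
by case: n b => [//|n] b [z hz] i j lt_ij; rewrite -!hz face_face.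
Qed.

(** [B i] is the intended boundary of an [i]-th face; the first hypothesis says
    that these boundaries fit together as those of the faces of one simplex.
    Fillings of the rows other than [B p] form a horn, and the [p]-th face of a
    filling of that horn has boundary [B p]. *)
Lemma kan_fill_last_row {K : sset} (hK : is_kan K) {n}
    (B : 'I_n.+3 -> 'I_n.+2 -> K n) (p : 'I_n.+3) :
  (forall i j : 'I_n.+3, i < j -> B j (inord i) = B i (inord j.-1)) ->
  (forall i, i != p -> is_boundary (B i)) -> is_boundary (B p).
Proof.
move=> compatB fillB.
have /fin_all_exists[f hf] (i : {i : 'I_n.+3 | i != p}) :
    exists z : K n.+1, forall j, face j z = B (val i) j.
  exact: fillB (valP i).
have [|w hw] := hK n.+1 p f.
  by move=> i j lt_ij; rewrite !hf compatB.
have {hf}hw i : i != p -> forall j, face j (face i w) = B i j.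
  by move=> ip j; rewrite (hw (exist _ i ip)) hf.
exists (face p w) => i; have [lt_ip | le_pi] := ltnP i p.
  pose i' : 'I_n.+3 := inord i.
  have i'E : i' = i :> nat by rewrite inordK // ltnS ltnW.
  have i'p : i' < p by rewrite i'E.
  have := compatB _ _ i'p; rewrite -[B i' _]hw ?neq_ltn ?i'p // -face_face //.
  by rewrite i'E inord_val => <-.
pose j : 'I_n.+3 := inord i.+1.
have jE : j = i.+1 :> nat by rewrite inordK // ltnS.
have pj : p < j by rewrite jE ltnS.
have := compatB _ _ pj; rewrite -[B j _]hw ?neq_ltn ?pj ?orbT // face_face //.
by rewrite jE /= inord_val => ->.
Qed.

(** The two modified boundaries and the boundaries of the other faces of [w]
    fit together, because the only entry that changes occurs exactly twice. *)
Lemma exchange_common_face {K : sset} (hK : is_kan K) {n} (w : K n.+2)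
    (p q : 'I_n.+3) (e : K n) : p < q ->
  is_boundary [eta (fun i => face i (face p w)) with inord q.-1 |-> e] <->
  is_boundary [eta (fun i => face i (face q w)) with inord p |-> e].
Proof.
move=> lt_pq.
pose Bp : 'I_n.+2 -> K n := [eta (fun i => face i (face p w)) with inord q.-1 |-> e].
pose Bq : 'I_n.+2 -> K n := [eta (fun i => face i (face q w)) with inord p |-> e].
pose B i := if i == p then Bp else if i == q then Bq
            else fun j => face j (face i w).
have qp : (q == p) = false by rewrite -val_eqE gtn_eqF.
have BpE : B p = Bp by rewrite /B eqxx.
have BqE : B q = Bq by rewrite /B qp eqxx.
have compatB (i j : 'I_n.+3) : i < j -> B j (inord i) = B i (inord j.-1).
  move=> lt_ij; have ltiS : i < n.+2 by rewrite (leq_trans lt_ij) // -ltnS.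
  have ltjS : j.-1 < n.+2 by rewrite -ltnS (ltn_predK lt_ij).
  have ltpS : p < n.+2 by rewrite (leq_trans lt_pq) // -ltnS.
  have ltqS : q.-1 < n.+2 by rewrite -ltnS (ltn_predK lt_pq).
  have inord_eq a b : a < n.+2 -> b < n.+2 ->
      (inord a == inord b :> 'I_n.+2) = (a == b).
    by move=> la lb; rewrite -val_eqE /= !inordK.
  have predE : (j.-1 == q.-1) = (j == q).
    by rewrite -eqSS (ltn_predK lt_ij) (ltn_predK lt_pq).
  have rowE (l : 'I_n.+3) m : B l m =
      if ((l == p) && (m == inord q.-1)) || ((l == q) && (m == inord p))
      then e else face m (face l w).
    rewrite /B /Bp /Bq; case: (l =P p) => [->|_] /=.
      by rewrite [p == q]eq_sym qp orbF.
    by case: (l =P q) => [->|_].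
  rewrite !rowE !inord_eq // predE face_face //.
  (* The off-diagonal conditions would put the indices in the wrong order:
     [j = p] and [i = q - 1], or [i = q] and [j - 1 = p]. *)
  have -> : (j == p) && (val i == q.-1) = false.
    apply/negP => /andP[/eqP jp /eqP iq]; move: lt_ij.
    by rewrite iq jp ltnNge -ltnS (ltn_predK lt_pq) lt_pq.
  have -> : (i == q) && (j.-1 == p) = false.
    apply/negP => /andP[/eqP iq /eqP jp]; move: lt_pq.
    by rewrite -iq -jp ltnNge -ltnS (ltn_predK lt_ij) lt_ij.
  by rewrite orbF /= andbC.
rewrite -/Bp -/Bq -BpE -BqE; split=> fill; apply: kan_fill_last_row => // i ir.
  rewrite /B; case: (i =P p) => [_|_]; first by rewrite -BpE.
  by rewrite (negPf ir); exists (face i w).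
rewrite /B (negPf ir); case: (i =P q) => [_|_]; first by rewrite -BqE.
by exists (face i w).
Qed.

Lemma homotopy_cycleE {K : sset} {n} (y y' : K n) :
  homotopy_cycle y y' =1
  [eta (fun i => face i (degen ord_max y)) with ord_max |-> y'].
Proof.
case: n y y' => [|n] y y' i /=; rewrite -val_eqE /=.
  case: i => -[|[|//]] lt_i //=.
  by rewrite face_degen_id.
case: ltnP => [lt_i | le_i].
  by rewrite ltn_eqF ?ltnS 1?ltnW // face_degen_lt //; congr degen;
     apply: val_inj; rewrite /= inordK.
case: (i =P n.+1 :> nat) => [iE | /eqP ni].
  by rewrite iE ltn_eqF // face_degen_id // iE eqxx.
have lt_i : n.+1 < i by rewrite ltn_neqAle eq_sym ni.
by rewrite ifT // eqn_leq lt_i -ltnS ltn_ord.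
Qed.

(** The degeneracy [w] of [z] that has both [z] and [s_n y] among its faces
    depends on the position of [y] in the boundary of [z]. *)
Lemma boundary_replace_homotopy {K : sset} (hK : is_kan K) {n} (z : K n.+1)
    (k : 'I_n.+2) (y' : K n) :
  is_boundary [eta (fun i => face i z) with k |-> y'] <->
  is_boundary (homotopy_cycle (face k z) y').
Proof.
apply: iff_trans (iff_sym (eq_is_boundary (homotopy_cycleE _ _))).
have inord_max m : inord m = ord_max :> 'I_m.+1.
  by apply: val_inj; rewrite /= inordK.
have [lt_k | le_k] := ltnP k n.+1.
  pose p : 'I_n.+3 := inord k.
  have pE : p = k :> nat by rewrite inordK // ltnS ltnW.
  have pS : p < n.+2 by rewrite pE.
  have := exchange_common_face hK (degen ord_max z) p ord_max y' pS.
  rewrite [face ord_max _]face_degen_id ?eqxx ?orbT //.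
  rewrite face_degen_lt /= ?pE //.
  by rewrite inord_val !inord_max => exch; apply: iff_sym.
have kE : k = ord_max.
  by apply: val_inj; apply/eqP; rewrite eqn_leq le_k -ltnS ltn_ord.
pose p : 'I_n.+3 := inord n.+1.
have pE : p = n.+1 :> nat by rewrite inordK.
have pS : p < n.+2 by rewrite pE.
have := exchange_common_face hK (degen (inord n : 'I_n.+2) z)
  p ord_max y' pS.
rewrite [face p _]face_degen_id ?pE ?inordK ?eqxx ?orbT //.
rewrite face_degen_gt /= ?inordK //.
by rewrite !inord_max kE.
Qed.

Theorem mainTheorem1 (K : sset) (hK : is_kan K) (n : nat) (k : 'I_n.+2)
    (x : 'I_n.+2 -> K n) (y y' : K n)
    (hc : is_boundary [eta x with k |-> y])
    (hy : same_boundary y' y) :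
  is_cycle [eta x with k |-> y'] /\
  (is_boundary [eta x with k |-> y'] <-> homotopic y y').
Proof.
split.
  move/is_boundary_cycle: hc; case: n k x y y' hy => [//|n] k x y y' hy hc i j ij.
  have faceE l m : face l ([eta x with k |-> y'] m) =
                   face l ([eta x with k |-> y] m).
    by rewrite /=; case: eqP => // _; apply: hy.
  by rewrite !faceE; apply: hc.
have [z hz] := hc.
apply: (@iff_trans _ (is_boundary (homotopy_cycle y y'))); last first.
  split=> [hyy' | []//]; split=> //.
  by case: n y y' hy {k x hc z hz hyy'} => [//|n] y y' hy i.
have <- : face k z = y by rewrite hz /= eqxx.
apply: iff_trans (boundary_replace_homotopy hK _ _ _).
apply: eq_is_boundary => i /=.
by case: eqP => // /eqP ik; rewrite hz /= (negPf ik).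
Qed.
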